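(* Let $\alpha\in\mathbb{R}\setminus\mathbb{Q}$ with continued fraction expansion $\alpha=[a_0;a_1,a_2,\dots]$. Then $\overline{g}(\alpha)=3$ if $a_n=1$ for infinitely many $n$, and $\overline{g}(\alpha)=2$ otherwise.
   Context: On $\mathbb{T}=\mathbb{R}/\mathbb{Z}$ let $dist(x,y)=\min_{t\in\mathbb{Z}}|x-y-t|$. For integers $N\ge1$ and $0\le q\le N$ put $D_q(N)=\min\{dist(q\alpha,k\alpha): 0\le k\le N,k\ne q\}$, let $g(\alpha,N)$ be the number of distinct values among $D_0(N),\dots,D_N(N)$, and $\overline{g}(\alpha)=\limsup_{N\to\infty}g(\alpha,N)$. *)

(* Defs.v *)
From mathcomp Require Export all_boot all_order all_algebra.
From mathcomp Require Export all_classical all_reals all_analysis.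

Set Implicit Arguments.
Unset Strict Implicit.
Unset Printing Implicit Defensive.

Import Order.TTheory GRing.Theory Num.Theory.

Local Open Scope classical_set_scope.
Local Open Scope ring_scope.

Section NearestNeighbours.
Variable R : realType.
Implicit Types (x y alpha : R) (q N : nat).

(* Points of R/Z are given by real representatives. The set is nonempty and
   bounded below and its infimum is attained, so inf is the minimum. *)
Definition circle_dist x y : R :=
  inf [set `|x - y - t%:~R| | t in [set: int]].

(* For N >= 1 the set is finite and nonempty, so inf is the minimum; the value
   at N = 0 is irrelevant, as only the limit N --> oo is considered. *)
Definition nn_dist alpha N q : R :=
  inf [set circle_dist (q%:R * alpha) (k%:R * alpha)
      | k in [set k : nat | (k <= N)%N /\ k <> q]].

Definition nn_count alpha N : nat :=
  size (undup [seq nn_dist alpha N q | q <- iota 0 N.+1]).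

Definition nn_count_limsup alpha : \bar R :=
  limn_esup (fun N => (nn_count alpha N)%:R%:E).

(* Complete quotients: alpha_0 = alpha, alpha_(n+1) = 1 / (alpha_n - floor
   alpha_n). For irrational alpha no denominator vanishes. *)
Fixpoint complete_quotient alpha (n : nat) : R :=
  if n is m.+1 then
    let x := complete_quotient alpha m in (x - (Num.floor x)%:~R)^-1
  else alpha.

(* The a_n of the regular continued fraction alpha = [a_0; a_1, a_2, ...]. *)
Definition partial_quotient alpha (n : nat) : int :=
  Num.floor (complete_quotient alpha n).

End NearestNeighbours.

(* Main.v *)
(* Since dist(q alpha, k alpha) depends only on |q - k|, D_q(N) is the minimum
   of ||m alpha|| over 1 <= m <= max(q, N - q). This running minimum changes
   exactly at the convergent denominators q_n, and max(q, N - q) runs through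
   [ceil(N/2), N], so g(alpha, N) is one plus the number of q_n in
   (ceil(N/2), N]. As q_(n+2) >= 2 q_n there are at most two of these, and two
   consecutive ones occur, for n large and a suitable N, iff
   q_(n+1) < 2 q_n, i.e. iff a_(n+1) = 1; with N = q_n there is at least one. *)
Require Import Defs.
From mathcomp Require Import zify ring lra.
Import Order.TTheory GRing.Theory Num.Theory.
Local Open Scope classical_set_scope.
Local Open Scope ring_scope.

(** * Irrationality, limits superior, sets of naturals, circle distance *)

Lemma irrational_neq_int (R : realType) (x : R) (m : int) :
  irrational x -> x != m%:~R.
Proof.
move=> xirr; apply/eqP => xm; apply: xirr.
by exists m%:~R; rewrite ?ratr_int.
Qed.

Lemma irrational_invB_int (R : realType) (x : R) (m : int) :
  irrational x -> irrational (x - m%:~R)^-1.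
Proof.
move=> xirr [q _ qE]; apply: xirr; exists (m%:~R + q^-1) => //.
by rewrite rmorphD/= fmorphV/= qE invrK ratr_int addrC subrK.
Qed.

(** [limn_esup] is an infimum of suprema over neighbourhoods of infinity, and the set where
    [u N <= l] is such a neighbourhood. *)
Lemma limn_esup_le_near (R : realType) (u : (\bar R)^nat) (l : \bar R) :
  (\forall N \near \oo, (u N <= l)%E) -> (limn_esup u <= l)%E.
Proof.
move=> ul; apply: (@le_trans _ _ (ereal_sup (u @` [set N | (u N <= l)%E]))).
  by apply: ereal_inf_lbound; exists [set N | (u N <= l)%E].
by apply: ge_ereal_sup => _ [N /= uN <-].
Qed.

Lemma limn_esup_ge_frequently (R : realType) (u : (\bar R)^nat) (l : \bar R) :
  (forall N0, exists2 N, (N0 <= N)%N & (l <= u N)%E) -> (l <= limn_esup u)%E.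
Proof.
move=> ul; apply: le_ereal_inf_tmp => _ [V [N0 _ N0V] <-].
have [N N0N lN] := ul N0; apply: (le_trans lN).
by apply: ereal_sup_ubound; exists N => //; apply: N0V.
Qed.

Lemma infinite_set_nat_ge (A : set nat) (n : nat) :
  infinite_set A -> exists2 m, (n <= m)%N & A m.
Proof.
move=> Ainf; apply: contrapT => noA; apply: Ainf.
apply: (@sub_finite_set _ _ `I_n); last exact: finite_II.
move=> m Am /=; rewrite ltnNge; apply/negP => nm.
by apply: noA; exists m.
Qed.

Lemma finite_set_nat_lt (A : set nat) :
  finite_set A -> exists n, forall m, A m -> (m < n)%N.
Proof.
move=> /finite_seqP[s ->]; exists (\max_(i <- s) i).+1 => m /= ms.
by rewrite ltnS; apply: (@leq_bigmax_seq _ s xpredT (fun i : nat => i)).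
Qed.

Lemma circle_dist_ge0 (R : realType) (x y : R) : 0 <= circle_dist x y.
Proof.
apply: lb_le_inf; first by exists `|x - y - 0%:~R|; exists 0.
by move=> _ [t _ <-].
Qed.

Lemma circle_dist_le (R : realType) (x y : R) (t : int) :
  circle_dist x y <= `|x - y - t%:~R|.
Proof.
apply: ge_inf; last by exists t.
by exists 0 => _ [u _ <-].
Qed.

(** * Convergents and their approximation errors *)

Section Convergents.
Variables (R : realType) (alpha : R).

(* The indices are shifted by one, so that the recursion starts from
   q_(-1) = 0 and p_(-1) = 1: conv_den n and conv_num n are q_(n-1) and
   p_(n-1). *)
Fixpoint conv_den (n : nat) : nat :=
  if n is m.+1 then
    if m is k.+1 then
      (`|partial_quotient alpha m| * conv_den m + conv_den k)%N
    else 1%N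
  else 0%N.

Fixpoint conv_num (n : nat) : int :=
  if n is m.+1 then
    if m is k.+1 then partial_quotient alpha m * conv_num m + conv_num k
    else partial_quotient alpha 0
  else 1.

(** With the shifted indices this is |q_(n-1) alpha - p_(n-1)|; the product form makes positivity
    and strict decrease immediate. *)
Fixpoint conv_err (n : nat) : R :=
  if n is m.+1 then conv_err m / complete_quotient alpha n else 1.

Arguments conv_den : simpl never.
Arguments conv_num : simpl never.
Arguments conv_err : simpl never.

Hypothesis alpha_irr : irrational alpha.

Lemma complete_quotient_irrational n : irrational (complete_quotient alpha n).
Proof. by elim: n => [//|n IHn]; apply: irrational_invB_int. Qed.

Lemma complete_quotient_gt1 n : 1 < complete_quotient alpha n.+1.
Proof.
rewrite /= invf_gt1.
  by rewrite ltrBlDr addrC -intrD1 floorD1_gt.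
rewrite subr_gt0 lt_neqAle floor_le andbT eq_sym.
exact/irrational_neq_int/complete_quotient_irrational.
Qed.

Lemma partial_quotient_ge1 n : 1 <= partial_quotient alpha n.+1.
Proof. by rewrite floor_ge_int ltW// complete_quotient_gt1. Qed.

Lemma conv_denSS n : conv_den n.+2 =
  (`|partial_quotient alpha n.+1| * conv_den n.+1 + conv_den n)%N.
Proof. by []. Qed.

Lemma conv_numSS n : conv_num n.+2 =
  partial_quotient alpha n.+1 * conv_num n.+1 + conv_num n.
Proof. by []. Qed.

Lemma leq_conv_denD n : (conv_den n.+1 + conv_den n <= conv_den n.+2)%N.
Proof.
rewrite conv_denSS leq_add2r leq_pmull// absz_gt0.
by apply: lt0r_neq0; apply: lt_le_trans (partial_quotient_ge1 n).
Qed.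

Lemma conv_den_gt0 n : (0 < conv_den n.+1)%N.
Proof.
elim: n => [//|n IHn]; apply: leq_trans (leq_conv_denD n).
exact: ltn_addr.
Qed.

Lemma conv_den_homo : {homo conv_den : m n / (m <= n)%N}.
Proof.
apply: homo_leq => // [|[//|n]]; first exact: leq_trans.
exact: leq_trans (leq_addr _ _) (leq_conv_denD n).
Qed.

(** The indices start at 2 because [conv_den 1] and [conv_den 2] coincide when a_1 = 1. *)
Lemma conv_den_ltS n : (conv_den n.+2 < conv_den n.+3)%N.
Proof.
apply: leq_trans (leq_conv_denD n.+1).
by rewrite -addn1 leq_add2l conv_den_gt0.
Qed.

Lemma conv_den_ge n : (n <= conv_den n.+1)%N.
Proof.
elim: n => [//|[|n] IHn]; first exact: conv_den_gt0.
exact: leq_ltn_trans IHn (conv_den_ltS n).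
Qed.

Lemma conv_den_interval M : (0 < M)%N ->
  exists n, (conv_den n.+1 <= M < conv_den n.+2)%N.
Proof.
move=> M0; have exM : exists n, (M < conv_den n.+1)%N.
  by exists M.+1; apply: conv_den_ge.
case: (ex_minnP exM) => -[|n] Mn minn.
  by move: Mn; rewrite ltnS leqNgt M0.
exists n; rewrite Mn andbT leqNgt; apply/negP => /minn.
by rewrite ltnn.
Qed.

(** Unimodularity: integer vectors have integer coordinates in the basis of two consecutive
    convergents. *)
Lemma conv_det n :
  (conv_den n.+1)%:Z * conv_num n - (conv_den n)%:Z * conv_num n.+1
  = (-1) ^+ n.
Proof.
elim: n => [|n IHn]; first by rewrite /conv_den /conv_num; ring.
rewrite conv_denSS conv_numSS exprS -IHn PoszD PoszM gez0_abs; last first.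
  exact: le_trans (partial_quotient_ge1 n).
by ring.
Qed.

Lemma conv_errS n : conv_err n.+1 = conv_err n / complete_quotient alpha n.+1.
Proof. by []. Qed.

Lemma conv_err_gt0 n : 0 < conv_err n.
Proof.
elim: n => [//|n IHn]; rewrite conv_errS divr_gt0//.
exact: lt_trans (complete_quotient_gt1 n).
Qed.

Lemma conv_err_ltS n : conv_err n.+1 < conv_err n.
Proof.
rewrite conv_errS ltr_pdivrMr; last exact: lt_trans (complete_quotient_gt1 n).
by rewrite ltr_pMr ?conv_err_gt0 ?complete_quotient_gt1.
Qed.

(** The recurrence of the convergents, with a minus sign because the signed errors alternate; it
    restates alpha_(n+1) = a_(n+1) + 1 / alpha_(n+2). *)
Lemma conv_errSS n : conv_err n.+2 =
  conv_err n - (partial_quotient alpha n.+1)%:~R * conv_err n.+1.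
Proof.
have cq0 : complete_quotient alpha n.+1 != 0.
  by apply: lt0r_neq0; apply: lt_trans (complete_quotient_gt1 n).
rewrite (conv_errS n.+1) [complete_quotient alpha n.+2]/= invrK.
rewrite -/(complete_quotient alpha n.+1) -/(partial_quotient alpha n.+1).
by rewrite conv_errS; field.
Qed.

Lemma conv_errE n :
  (conv_den n)%:R * alpha - (conv_num n)%:~R = (-1) ^+ n.+1 * conv_err n.
Proof.
suff [] : (conv_den n)%:R * alpha - (conv_num n)%:~R
            = (-1) ^+ n.+1 * conv_err n /\
          (conv_den n.+1)%:R * alpha - (conv_num n.+1)%:~R
            = (-1) ^+ n.+2 * conv_err n.+1 by [].
elim: n => [|n [IH0 IH1]].
  split; rewrite /conv_den /conv_num /conv_err /=; first by ring.
  by rewrite invrK /partial_quotient /=; ring.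
split => //; rewrite conv_errSS conv_denSS conv_numSS natrD natrM.
rewrite rmorphD rmorphM /= natr_absz ger0_norm; last first.
  exact: le_trans (partial_quotient_ge1 n).
move: IH0 IH1; rewrite !exprS => IH0 IH1.
set a := (partial_quotient alpha n.+1)%:~R.
have -> : (a * (conv_den n.+1)%:R + (conv_den n)%:R) * alpha
          - (a * (conv_num n.+1)%:~R + (conv_num n)%:~R)
  = a * ((conv_den n.+1)%:R * alpha - (conv_num n.+1)%:~R)
    + ((conv_den n)%:R * alpha - (conv_num n)%:~R) by ring.
by rewrite IH0 IH1; ring.
Qed.

(* The convergents n and n.+1 form a basis of Z^2. The bound on m
   forces the two coordinates of (m, t) in this basis to have opposite signs,
   while the two errors have opposite signs, so their contributions add up. *)
Lemma best_approximation n m (t : int) :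
  (0 < m < conv_den n.+1)%N -> conv_err n <= `|m%:R * alpha - t%:~R|.
Proof.
move=> mn; pose s : int := (-1) ^+ n.
have ss : s * s = 1 by rewrite /s -expr2 sqrr_sign.
(* Cramer's rule; the determinant [s] is its own inverse. *)
pose x := s * ((conv_den n.+1)%:Z * t - conv_num n.+1 * m%:Z).
pose y := s * (conv_num n * m%:Z - (conv_den n)%:Z * t).
have mE : m%:Z = x * (conv_den n)%:Z + y * (conv_den n.+1)%:Z.
  transitivity (s * ((conv_den n.+1)%:Z * conv_num n
                     - (conv_den n)%:Z * conv_num n.+1) * m%:Z).
    by rewrite conv_det -/s ss mul1r.
  by rewrite /x /y; ring.
have tE : t = x * conv_num n + y * conv_num n.+1.
  transitivity (s * ((conv_den n.+1)%:Z * conv_num n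
                     - (conv_den n)%:Z * conv_num n.+1) * t).
    by rewrite conv_det -/s ss mul1r.
  by rewrite /x /y; ring.
clearbody x y.
have -> : m%:R * alpha - t%:~R
    = (-1) ^+ n.+1 * (x%:~R * conv_err n - y%:~R * conv_err n.+1).
  have -> : m%:R = x%:~R * (conv_den n)%:R + y%:~R * (conv_den n.+1)%:R :> R.
    by have := congr1 (fun z : int => z%:~R : R) mE; rewrite rmorphD !rmorphM.
  rewrite tE rmorphD !rmorphM /=.
  transitivity (x%:~R * ((conv_den n)%:R * alpha - (conv_num n)%:~R)
    + y%:~R * ((conv_den n.+1)%:R * alpha - (conv_num n.+1)%:~R)).
    by ring.
  by rewrite !conv_errE !exprS; ring.
rewrite normrM normrX normrN1 expr1n mul1r.
have e0 := conv_err_gt0 n; have e1 := conv_err_gt0 n.+1.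
(* If [y <= 0], then [x <= 0] would give [m <= 0]; if [1 <= y], then [0 <= x] would give
   [m >= conv_den n.+1]. *)
have [[x1 y0]|[x1 y1]] : (1 <= x /\ y <= 0) \/ (x <= -1 /\ 1 <= y).
- have [y0|y1] : y <= 0 \/ 1 <= y by lia.
    left; split => //; rewrite leNgt; apply/negP => x1.
    have : x * (conv_den n)%:Z <= 0 by apply: mulr_le0_ge0 => //; lia.
    have : y * (conv_den n.+1)%:Z <= 0 by apply: mulr_le0_ge0.
    by move: mE mn; lia.
  right; split => //; rewrite leNgt; apply/negP => x1.
  have : 0 <= x * (conv_den n)%:Z by apply: mulr_ge0 => //; lia.
  have : 1 * (conv_den n.+1)%:Z <= y * (conv_den n.+1)%:Z by apply: ler_wpM2r.
  by move: mE mn; lia.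
- have x1R : 1 <= x%:~R :> R by rewrite (_ : 1 = 1%:~R)// ler_int.
  have y0R : y%:~R <= 0 :> R by rewrite lerz0.
  by rewrite (le_trans _ (ler_norm _))//; nra.
- have x1R : x%:~R <= -1 :> R by rewrite (_ : -1 = (-1)%:~R)// ler_int.
  have y1R : 1 <= y%:~R :> R by rewrite (_ : 1 = 1%:~R)// ler_int.
  by rewrite -normrN (le_trans _ (ler_norm _))//; nra.
Qed.

(** * Nearest-neighbour distances as convergent errors *)

Lemma nn_dist_le N q k : (k <= N)%N -> k <> q ->
  nn_dist alpha N q <= circle_dist (q%:R * alpha) (k%:R * alpha).
Proof.
move=> kN kq; apply: ge_inf; last by exists k.
by exists 0 => _ [j _ <-]; apply: circle_dist_ge0.
Qed.

(** Every difference |q - k| lies between 1 and [maxn q (N - q)], so [best_approximation] bounds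
    each distance. *)
Lemma nn_dist_ge_conv_err N q n :
  (0 < N)%N -> (maxn q (N - q) < conv_den n.+1)%N ->
  conv_err n <= nn_dist alpha N q.
Proof.
move=> N0 qN; apply: lb_le_inf.
  pose k := if q is 0%N then 1%N else 0%N.
  exists (circle_dist (q%:R * alpha) (k%:R * alpha)); exists k => //=.
  by rewrite /k; case: (q).
move=> _ [k [kN kq] <-]; apply: lb_le_inf.
  by exists `|q%:R * alpha - k%:R * alpha - 0%:~R|; exists 0.
move=> _ [t _ <-]; have [kltq|qltk|/esym//] := ltngtP k q.
  rewrite -mulrBl -natrB ?(ltnW kltq)//; apply: best_approximation; lia.
rewrite -normrN !opprD opprK (addrC (- _)) -mulrBl -natrB ?(ltnW qltk)//.
by rewrite -rmorphN; apply: best_approximation; lia.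
Qed.

Lemma nn_dist_le_conv_err N q n : (q <= N)%N ->
  (conv_den n.+1 <= maxn q (N - q))%N -> nn_dist alpha N q <= conv_err n.+1.
Proof.
move=> qN nM; have d0 := conv_den_gt0 n.
have dE : conv_err n.+1 = `|(conv_den n.+1)%:R * alpha - (conv_num n.+1)%:~R|.
  rewrite conv_errE normrM normrX normrN1 expr1n mul1r gtr0_norm//.
  exact: conv_err_gt0.
(* The neighbour is [conv_den n.+1] steps to the left of [q] if that stays nonnegative, otherwise to
   the right, where it stays within [N]. *)
have [dq|qd] := leqP (conv_den n.+1) q.
  apply: (@le_trans _ _ (circle_dist (q%:R * alpha)
                           ((q - conv_den n.+1)%:R * alpha))).
    by apply: nn_dist_le; lia.
  apply: le_trans (circle_dist_le _ _ _ (conv_num n.+1)) _.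
  by rewrite dE -mulrBl -natrB ?leq_subr// subKn.
apply: (@le_trans _ _ (circle_dist (q%:R * alpha)
                         ((q + conv_den n.+1)%:R * alpha))).
  by apply: nn_dist_le; lia.
apply: le_trans (circle_dist_le _ _ _ (- conv_num n.+1)) _.
by rewrite dE -normrN -mulrBl !opprD -mulNr opprB -natrB ?leq_addr// addKn
  rmorphN opprK.
Qed.

Lemma nn_dist_conv_err N q n : (q <= N)%N ->
  (conv_den n.+1 <= maxn q (N - q) < conv_den n.+2)%N ->
  nn_dist alpha N q = conv_err n.+1.
Proof.
move=> qN /andP[nM Mn]; apply/le_anti/andP; split.
  exact: nn_dist_le_conv_err.
by apply: nn_dist_ge_conv_err => //; have := conv_den_gt0 n; lia.
Qed.

(** * Bounds on the number of distinct distances *)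

Lemma nn_count_le N (s : seq R) :
  (forall q, (q <= N)%N -> nn_dist alpha N q \in s) ->
  (nn_count alpha N <= size s)%N.
Proof.
move=> Ns; apply: uniq_leq_size (undup_uniq _) _ => x.
rewrite mem_undup => /mapP[q]; rewrite mem_iota add0n ltnS => qN ->.
exact: Ns.
Qed.

Lemma nn_count_ge N (s : seq nat) :
  all (fun q => q <= N)%N s -> uniq [seq nn_dist alpha N q | q <- s] ->
  (size s <= nn_count alpha N)%N.
Proof.
move=> /allP sN us; rewrite -(size_map (nn_dist alpha N)).
apply: uniq_leq_size us _ => x /mapP[q qs ->].
by rewrite mem_undup map_f// mem_iota add0n ltnS sN.
Qed.

Lemma nn_count_le3 N : (0 < N)%N -> (nn_count alpha N <= 3)%N.
Proof.
move=> N0.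
(* [N - N./2] is ceil(N/2), the least value of [maxn q (N - q)]. As
   [conv_den n.+4 >= 2 * conv_den n.+2 > N], only three intervals between denominators are met. *)
have [|n /andP[nN Nn]] := @conv_den_interval (N - N./2); first by lia.
apply: (@nn_count_le _ [:: conv_err n.+1; conv_err n.+2; conv_err n.+3]).
move=> q qN.
have h1 := leq_conv_denD n.+1; have h2 := leq_conv_denD n.+2.
have [Mn1|Mn1] := ltnP (maxn q (N - q)) (conv_den n.+2).
  by rewrite (@nn_dist_conv_err N q n) ?inE ?eqxx//; lia.
have [Mn2|Mn2] := ltnP (maxn q (N - q)) (conv_den n.+3).
  by rewrite (@nn_dist_conv_err N q n.+1) ?inE ?eqxx ?orbT//; lia.
by rewrite (@nn_dist_conv_err N q n.+2) ?inE ?eqxx ?orbT//; lia.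
Qed.

Lemma nn_count_le2 N n0 :
  (forall n, (n0 <= n)%N -> partial_quotient alpha n <> 1) ->
  (conv_den n0.+1 <= N./2)%N -> (nn_count alpha N <= 2)%N.
Proof.
move=> pq1 n0N; have d0 := conv_den_gt0 n0.
have [|n /andP[nN Nn]] := @conv_den_interval (N - N./2); first by lia.
have n0n : (n0 <= n)%N.
  rewrite leqNgt; apply/negP => nn0.
  by have := @conv_den_homo n.+2 n0.+1 nn0; lia.
(* Here the partial quotient is at least 2, so [conv_den n.+3] exceeds [N] and only two intervals
   remain. *)
have h1 : (2 * conv_den n.+2 <= conv_den n.+3)%N.
  rewrite (conv_denSS n.+1) (leq_trans _ (leq_addr _ _))// leq_mul2r.
  apply/orP; right; have := pq1 n.+2; have := partial_quotient_ge1 n.+1; lia.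
apply: (@nn_count_le N [:: conv_err n.+1; conv_err n.+2]) => q qN.
have [Mn1|Mn1] := ltnP (maxn q (N - q)) (conv_den n.+2).
  by rewrite (@nn_dist_conv_err N q n) ?inE ?eqxx//; lia.
by rewrite (@nn_dist_conv_err N q n.+1) ?inE ?eqxx ?orbT//; lia.
Qed.

(** From the end point 0 the denominator [N] itself is reachable; from the midpoint only smaller
    differences are. *)
Lemma nn_count_ge2 n : (2 <= nn_count alpha (conv_den n.+3))%N.
Proof.
set N := conv_den n.+3.
have N2 : (2 <= N)%N by apply: leq_trans (conv_den_ge n.+2).
apply: (@nn_count_ge N [:: 0%N; N./2]) => /=; first by lia.
rewrite inE andbT; apply/negbT/lt_eqF.
rewrite (@nn_dist_conv_err N 0 n.+2)//; last first.
  by rewrite subn0 max0n leqnn conv_den_ltS.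
apply: lt_le_trans (conv_err_ltS _) _.
by apply: nn_dist_ge_conv_err; rewrite -/N; lia.
Qed.

(** The points 0, [conv_den n.+3] and [N./2] have maximal differences [N], [conv_den n.+3] and
    something smaller than [conv_den n.+3]. *)
Lemma nn_count_ge3 n : (2 <= n)%N -> partial_quotient alpha n.+3 = 1 ->
  (3 <= nn_count alpha (conv_den n.+4))%N.
Proof.
move=> n2 pq1; set N := conv_den n.+4.
have NE : N = (conv_den n.+3 + conv_den n.+2)%N.
  by rewrite /N conv_denSS pq1 absz1 mul1n.
(* [conv_den n.+3] and [conv_den n.+2] must differ by at least 2: with a gap of 1, ceil(N/2) would
   equal [conv_den n.+3]. *)
have d1 := leq_trans n2 (conv_den_ge n).
have d2 := leq_conv_denD n.+1; have d3 := conv_den_gt0 n.+1.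
have NS : (N < conv_den n.+4.+1)%N := conv_den_ltS _.
have e0 : nn_dist alpha N 0 = conv_err n.+4.
  by apply: nn_dist_conv_err; rewrite // subn0 max0n leqnn.
have e1 : nn_dist alpha N (conv_den n.+3) = conv_err n.+3.
  by apply: nn_dist_conv_err; rewrite -/N; lia.
have e2 : conv_err n.+2 <= nn_dist alpha N N./2.
  by apply: nn_dist_ge_conv_err; lia.
have lt1 := conv_err_ltS n.+3; have lt2 := conv_err_ltS n.+2.
apply: (@nn_count_ge N [:: 0%N; conv_den n.+3; N./2]) => /=; first by lia.
rewrite !inE e0 e1 negb_or andbT (lt_eqF lt1) !lt_eqF//.
  exact: lt_le_trans lt2 e2.
exact: lt_trans lt1 (lt_le_trans lt2 e2).
Qed.

End Convergents.

(** * Passage to the limit superior *)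

Theorem theorem5 (R : realType) (alpha : R) (alpha_irr : irrational alpha) :
  (infinite_set [set n : nat | partial_quotient alpha n = 1] ->
     nn_count_limsup alpha = 3%:E) /\
  (~ infinite_set [set n : nat | partial_quotient alpha n = 1] ->
     nn_count_limsup alpha = 2%:E).
Proof.
split => [inf1|fin1]; apply/le_anti/andP; split.
- apply: limn_esup_le_near; exists 1%N => // N /= N0.
  by rewrite lee_fin ler_nat nn_count_le3.
- apply: limn_esup_ge_frequently => N0.
  (* The 5 ensures [2 <= m - 3], as [nn_count_ge3] requires. *)
  have [m N0m pq1] := infinite_set_nat_ge _ (N0 + 5)%N inf1.
  have mE : m = (m - 3).+3 by lia.
  exists (conv_den R alpha (m - 3).+4).
    by apply: leq_trans (conv_den_ge _ _ alpha_irr _); lia.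
  by rewrite lee_fin ler_nat nn_count_ge3 -?mE//; lia.
- move: fin1 => /contrapT/finite_set_nat_lt[n0 n0P].
  (* Doubling makes [N./2] reach [conv_den n0.+1]. *)
  apply: limn_esup_le_near; exists (conv_den R alpha n0.+1).*2 => // N N0.
  rewrite lee_fin ler_nat (@nn_count_le2 _ _ _ _ n0)//.
    by move=> n n0n /n0P; lia.
  by rewrite -[leqLHS]doubleK half_leq.
- apply: limn_esup_ge_frequently => N0.
  exists (conv_den R alpha N0.+3).
    by apply: leq_trans (conv_den_ge _ _ alpha_irr _); lia.
  by rewrite lee_fin ler_nat nn_count_ge2.
Qed.
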